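(* Let $G=(V,E)$ be a (possibly infinite) directed graph in which every vertex has finite in-degree. Then $G$ has a quasi-kernel.
   Context: A digraph (directed graph) is a pair $G=(V,E)$ with $E\subseteq V\times V$; $V$ may be infinite. A set $A\subseteq V$ is independent if there is no edge (in either direction) between two distinct elements of $A$. An independent set $A\subseteq V$ is a quasi-kernel of $G$ if for each $v\in V$ there is a directed path of length at most $2$ from some point of $A$ to $v$ (length $0$ is allowed). *)

(* Defs.v *)
From mathcomp Require Import all_boot classical_sets functions cardinality.

Set Implicit Arguments.
Unset Strict Implicit.
Unset Printing Implicit Defensive.

Local Open Scope classical_set_scope.

(* A digraph is a vertex type [V] (of any cardinality, possibly empty) together
   with an edge set [E : set (V * V)]; loops and antiparallel edges are allowed.
   [(u, v)] is the edge from [u] to [v]. *)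

Definition in_neighbours (V : Type) (E : set (V * V)) (v : V) : set V :=
  [set u | E (u, v)].

Definition finite_indegree (V : Type) (E : set (V * V)) : Prop :=
  forall v, finite_set (in_neighbours E v).

Definition independent (V : Type) (E : set (V * V)) (A : set V) : Prop :=
  forall a b, A a -> A b -> a <> b -> ~ E (a, b).

(* Only the values [p 0], ..., [p n] matter; they are the vertices of the path,
   which are pairwise distinct. *)
Definition dipath (V : Type) (E : set (V * V)) (n : nat) (u v : V) : Prop :=
  exists p : nat -> V,
    [/\ p 0 = u, p n = v,
        forall i, i < n -> E (p i, p i.+1) &
        forall i j, i <= n -> j <= n -> p i = p j -> i = j].

Definition quasi_kernel (V : Type) (E : set (V * V)) (A : set V) : Prop :=
  independent E A /\
  forall v, exists a n, [/\ A a, n <= 2 & dipath E n a v].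

(* Main.v *)
(* For a finite set S of vertices there is an independent set reaching every
   vertex of S within two steps (Chvátal–Lovász): pick v in S, solve the problem
   for S minus v and its out-neighbours, and add v to the solution unless the
   solution already has an edge into v.  An ultrafilter limit of these
   independent sets is independent, and it still reaches every vertex v because,
   in-degrees being finite, v has only finitely many vertices within two steps
   behind it, so one of them lies in almost all of the independent sets. *)
Require Import Defs.
From mathcomp Require Import all_boot classical_sets functions cardinality.
From mathcomp Require Import boolp finmap filter.

Set Implicit Arguments.
Unset Strict Implicit.
Unset Printing Implicit Defensive.

Local Open Scope classical_set_scope.

Definition two_step_ball (V : Type) (E : set (V * V)) (v : V) : set V :=
  [set v] `|` in_neighbours E v `|`
  \bigcup_(w in in_neighbours E v) in_neighbours E w.

Lemma finite_two_step_ball (V : Type) (E : set (V * V)) (v : V) :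
  finite_indegree E -> finite_set (two_step_ball E v).
Proof.
move=> hE; rewrite !finite_setU; split; first by split; [exact: finite_set1|].
by apply: bigcup_finite => // w _; exact: hE.
Qed.

(** The vertices of a [dipath] are distinct, so two consecutive edges need not form one: when two of
    [a], [w], [v] coincide, a shorter path is taken. *)
Lemma two_step_ball_dipath (V : Type) (E : set (V * V)) (a v : V) :
  two_step_ball E v a -> exists2 n, n <= 2 & dipath E n a v.
Proof.
have step (u w : V) : u <> w -> E (u, w) -> dipath E 1 u w.
  move=> uw Euw; exists (fun i => if i is 0 then u else w); split=> //.
    by case.
  by move=> [|[|i]] [|[|j]] // _ _ /= eq_uw; case: uw.
have [-> _|av] := pselect (a = v).
  exists 0 => //; exists (fun=> v); split=> // i j.
  by rewrite !leqn0 => /eqP-> /eqP->.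
case=> [[/av//|Eav]|[w Ewv Eaw]]; first by exists 1 => //; exact: step.
have [aw|aw] := pselect (a = w).
  by exists 1 => //; apply: step => //; rewrite aw.
have [wv|wv] := pselect (w = v).
  by exists 1 => //; apply: step => //; rewrite -wv.
exists 2 => //.
exists (fun i => if i is i'.+1 then if i' is 0 then w else v else a).
split=> //; first by move=> [|[|i]].
by move=> [|[|[|i]]] [|[|[|j]]] // _ _ /= h; (case: av + case: aw + case: wv).
Qed.

(** Confining [A] to an arbitrary [P] lets the induction discard [x] and its out-neighbours: no edge
    then runs from [x] into [A], and only an edge into [x] can prevent adding [x]. *)
Lemma seq_quasi_kernel (V : eqType) (E : set (V * V)) (s : seq V) (P : set V) :
  exists A : set V, [/\ A `<=` P, independent E A &
    forall v, v \in s -> P v -> A `&` two_step_ball E v !=set0].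
Proof.
elim: s P => [|x s IH] P; first by exists set0; split=> // ? ? [].
have [Px|nPx] := pselect (P x); last first.
  have [A [AP indA domA]] := IH P; exists A; split=> // v.
  by rewrite inE => /orP[/eqP->|/domA].
have [A [AP indA domA]] := IH (P `&` [set y | y <> x /\ ~ E (x, y)]).
(* Such an [a] reaches [x] in one step and the out-neighbours of [x] in two, so [A] already
   suffices. *)
have [[a Aa Eax]|noedge] := pselect (exists2 a, A a & E (a, x)).
  exists A; split=> // [y /AP[]//|v vs Pv].
  have [->|vx] := pselect (v = x); first by exists a; split=> //; left; right.
  have [Exv|nExv] := pselect (E (x, v)).
    by exists a; split=> //; right; exists x.
  by apply: domA => //; move: vs; rewrite inE => /orP[/eqP|].
exists (x |` A); split.
- by move=> y [->//|/AP[]].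
- move=> a b [->|Aa] [->|Ab] ab //.
  + by have [_ []] := AP _ Ab.
  + by move=> Eax; apply: noedge; exists a.
  + exact: indA.
- move=> v vs Pv.
  have [->|vx] := pselect (v = x); first by exists x; split; left => //; left.
  have [Exv|nExv] := pselect (E (x, v)).
    by exists x; split; [left|left; right].
  have vs' : v \in s by move: vs; rewrite inE => /orP[/eqP|].
  have [//|a [Aa av]] := domA v vs'.
  by exists a; split=> //; right.
Qed.

(** Were no [f i] in [F], all their complements would be, and the finite intersection of these
    misses the union. *)
Lemma ultra_bigcup_finite (T I : Type) (F : set_system T) (D : set I)
    (f : I -> set T) :
  UltraFilter F -> finite_set D -> F (\bigcup_(i in D) f i) ->
  exists2 i, D i & F (f i).
Proof.
elim/Pchoice: I => I in D f *.
move=> FU /finite_fsetP[X ->] FX; apply: contrapT => nF.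
have FXC : F (\bigcap_(i in [set` X]) ~` f i).
  apply: filter_bigI => i iX; have [Ffi|//] := in_ultra_setVsetC (f i) FU.
  by case: nF; exists i.
have [t [[i iX fit] /(_ i iX)]] := filter_ex (filterI FX FXC).
by apply.
Qed.

Theorem corollary2p1 (V : Type) (E : set (V * V)) (hE : finite_indegree E) :
  exists A : set V, quasi_kernel E A.
Proof.
elim/Pchoice: V => V in E hE *.
pose Q (s : seq V) : set (set V) := [set A | independent E A /\
  forall v, v \in s -> A `&` two_step_ball E v !=set0].
(* The [Q s] form a filter base: [Q (s ++ t)] lies in both [Q s] and [Q t], and none is empty by the
   finite case. *)
have QF : ProperFilter (filter_from setT Q).
  apply: filter_from_proper; last first.
    move=> s _; have [A [_ indA domA]] := seq_quasi_kernel E s setT.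
    by exists A; split=> // v vs; exact: domA.
  apply: filter_fromT_filter; first by exists [::].
  move=> s t; exists (s ++ t) => A [indA domA].
  by split; split=> // v vs; apply: domA; rewrite mem_cat vs ?orbT.
have [U [UU FU]] := ultraFilterLemma QF.
have UQ s : U (Q s) by apply: FU; exists s.
exists [set a | U [set A | A a]]; split.
  move=> a b Ua Ub ab.
  (* Every [Q s] demands independence, so the empty list is enough here. *)
  have [A [[Aa Ab] [indA _]]] := filter_ex (filterI (filterI Ua Ub) (UQ [::])).
  exact: indA.
move=> v.
have : U (\bigcup_(a in two_step_ball E v) [set A | A a]).
  apply: filterS (UQ [:: v]) => A [_ /(_ v (mem_head _ _)) [a [Aa av]]].
  by exists a.
move=> /(ultra_bigcup_finite UU (finite_two_step_ball v hE))[a av Ua].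
have [n n2 p] := two_step_ball_dipath av.
by exists a, n.
Qed.
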